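(* There exist absolute constants $c, C > 0$ such that for all integers $m \ge 1$, $0 \le t \le m$ and $n \ge c\, m^3 \log^2 m$ (with $n\ge 1$), if $M$ is an $m\times n$ random $t$-sparse matrix, then $$\operatorname{disc}(M) \le 2$$ with probability at least $1 - C\sqrt{\frac{m \log n}{n}}$.
   Context: An $m \times n$ random $t$-sparse matrix is a matrix whose $n$ columns are independent, each chosen uniformly at random from the set of vectors in $\{0,1\}^m$ with exactly $t$ ones and $m-t$ zeroes. For a real $m\times n$ matrix $M$, $\operatorname{disc}(M) = \min_{v \in \{+1,-1\}^n}\|Mv\|_\infty$. *)

(* Defs.v *)
From HB Require Import structures.
From mathcomp Require Export all_boot all_order all_algebra.
From mathcomp Require Export all_classical all_reals all_analysis.

Set Implicit Arguments.
Unset Strict Implicit.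
Unset Printing Implicit Defensive.

Import Order.TTheory GRing.Theory Num.Theory.
Import numFieldNormedType.Exports.

Local Open Scope classical_set_scope.
Local Open Scope ring_scope.

Definition is_sign_vec (R : realType) (n : nat) (v : 'cV[R]_n) : Prop :=
  forall j, v j 0 = 1 \/ v j 0 = -1.

(* On column vectors, `|x| is the library's sup norm [mx_norm].  The infimum
   ranges over a nonempty finite set, hence is a minimum: see [discP]. *)
Definition disc (R : realType) (m n : nat) (M : 'M[R]_(m, n)) : R :=
  inf [set `|M *m v| | v in [set v : 'cV[R]_n | is_sign_vec v]].

Lemma discP (R : realType) (m n : nat) (M : 'M[R]_(m, n)) :
  (exists2 v : 'cV[R]_n, is_sign_vec v & `|M *m v| = disc M) /\
  (forall v : 'cV[R]_n, is_sign_vec v -> disc M <= `|M *m v|).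
Proof.
pose sg (s : {ffun 'I_n -> bool}) : 'cV[R]_n := \col_j (-1) ^+ s j.
have sgP s : is_sign_vec (sg s).
  by move=> j; rewrite mxE; case: (s j); [right|left].
have sg_surj v : is_sign_vec v -> exists s, v = sg s.
  move=> sv; exists [ffun j => v j 0 == -1]; apply/colP => j.
  rewrite !mxE ffunE; case: (sv j) => ->; last by rewrite eqxx.
  by rewrite -addr_eq0 -(natrD _ 1 1) pnatr_eq0.
pose s0 : {ffun 'I_n -> bool} := [ffun=> false].
have [s smin] : exists s, forall s', `|M *m sg s| <= `|M *m sg s'|.
  have [s _ smin] := @Order.TotalTheory.arg_minP _ _ _ s0 xpredT
    (fun s => `|M *m sg s|) isT.
  by exists s => s'; exact: smin.
have lb v : is_sign_vec v -> `|M *m sg s| <= `|M *m v|.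
  by move=> /sg_surj[s' ->]; apply: smin.
suff E : `|M *m sg s| = disc M.
  by split; [exists (sg s) => //; exact: sgP|move=> v /lb; rewrite E].
have ne : [set `|M *m v| | v in [set v : 'cV[R]_n | is_sign_vec v]] !=set0.
  by exists `|M *m sg s|, (sg s) => //; exact: sgP.
apply/eqP; rewrite eq_le; apply/andP; split.
  by apply: lb_le_inf => // _ [v /lb lv <-].
apply: ge_inf; [exists 0 => _ [v _ <-]; exact: normr_ge0|].
by exists (sg s) => //; exact: sgP.
Qed.

Definition sparse_vecs (m t : nat) : {set 'cV[bool]_m} :=
  [set x : 'cV[bool]_m | #|[set i | x i 0]%SET| == t]%SET.

Definition uniform_on (d : measure_display) (T : measurableType d)
    (R : realType) (P : probability T R) (U : finType)
    (X : T -> U) (S : {set U}) : Prop :=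
  forall x : U, P [set w | X w = x] = ((x \in S)%:R / #|S|%:R)%:E.

Definition mutually_independent (d : measure_display) (T : measurableType d)
    (R : realType) (P : probability T R) (I U : finType)
    (X : I -> T -> U) : Prop :=
  forall (J : {set I}) (A : I -> set U),
    P (\bigcap_(j in [set` J]) (X j @^-1` A j)) =
    (\prod_(j in J) P (X j @^-1` A j))%E.

(* A random 0/1 matrix is encoded with entries in [bool]; [real_mx] reads it as
   a real matrix. *)
Definition real_mx (R : realType) (m n : nat) (M : 'M[bool]_(m, n)) :
    'M[R]_(m, n) :=
  map_mx (fun b : bool => b%:R) M.

Definition random_sparse_mx (d : measure_display) (T : measurableType d)
    (R : realType) (P : probability T R) (m n t : nat)
    (M : T -> 'M[bool]_(m, n)) : Prop :=
  [/\ forall i j, measurable_fun setT (fun w => M w i j),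
      mutually_independent P (fun j w => col j (M w)) &
      forall j, uniform_on P (fun w => col j (M w)) (sparse_vecs m t)].

(* Main.v *)
From mathcomp Require Import fingroup perm ring lra zify.
Require Import Defs.

(** The proof is a first-moment argument on the Fourier side.  Fix a modulus
    [N], and let [X_1], ..., [X_n] be the columns of [M].  Expanding products of
    cosines, the number of sign vectors [v] with [M v = z] modulo [N] equals
    [2 ^ n / N ^ m] times the sum, over the grid of frequencies [th] in
    [(2 pi / N) (Z / N) ^ m], of
      [G(th) = cos <th, z> * cos <th, X_1> * ... * cos <th, X_n>].
    So if no signing reaches [z], the sum of [G] vanishes
    ([sum_cos_prod_cos_grid]); with [N = n + 3] and [z] bounded by 2,
    congruence modulo [N] and equality are the same.  It remains to find a [z]
    with entries in [-2, 2] for which the sum of [G] is positive.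

    The target, for [0 < t < m].  A necessary condition for [M v = z] is that [z] and
    [X_1 + ... + X_n] agree modulo twice the lattice spanned by the
    [t]-sparse vectors, that is, the integer vectors whose coordinate sum is a
    multiple of [t].  This class contains a small vector, whose coordinate sum
    can even be taken to be 0 or [t] according to the parity of [n]
    ([exists_target]).

    Frequencies with a sign.  Suppose that [<th, X>] is on average close to
    [pi Z] for a random [t]-sparse [X], in the sense that the mean of
    [|sin <th, X>|] is at most [rho = 1 / (18 m)].  Exchanging one element of
    the support of [X] for another shows that the coordinates of [th] are all
    close to each other modulo [pi]; hence, up to multiples of [pi],
    [<th, X>] is uniformly small for every [t]-sparse [X], and so is
    [<th, z>] ([lift_of_abs_sin_le]).  The signs produced by the multiples of
    [pi] cancel because of the congruence satisfied by [z], and so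
    [G(th) >= 0] ([cos_prod_cos_ge0]).  The frequency 0 alone contributes 1.

    All other frequencies.  There the mean of [|cos <th, X>|] is at most
    [1 - rho ^ 2 / 2] ([sum_norm_cos_le]), so by independence [|G(th)|] has
    expectation at most [(1 - rho ^ 2 / 2) ^ n].  The grid has only
    [(n + 3) ^ m] points, and [n >= c m ^ 3 ln ^ 2 m] makes the expected total
    contribution at most [1 / n] ([tail_le_inv]).  By Markov's inequality this
    contribution is less than 1, hence the sum of [G] is positive, except with
    probability at most [1 / n], which is below the required bound.

    When [t = 0] or [t = m] the matrix is constant and alternating signs give
    discrepancy at most 1. *)

Set Implicit Arguments.
Unset Strict Implicit.
Unset Printing Implicit Defensive.

Import Order.TTheory GRing.Theory Num.Theory.
Import numFieldNormedType.Exports.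

Local Open Scope classical_set_scope.
Local Open Scope ring_scope.

(** * Trigonometry modulo multiples of pi *)

Section Trig.
Variable R : realType.
Implicit Types x : R.

Lemma cosD_intpi x (k : int) : cos (x + k%:~R * pi) = (-1) ^ k * cos x.
Proof.
have nat_case y (j : nat) : cos (y + j%:R * pi) = (-1) ^+ j * cos y.
  elim: j => [|j IH]; first by rewrite mul0r addr0 expr0 mul1r.
  by rewrite -natr1 mulrDl mul1r addrA cosDpi IH exprS mulN1r mulNr.
case: k => j; first exact: nat_case.
have -> : (-1) ^ Negz j = (-1) ^+ j.+1 :> R by rewrite /exprz invr_sign.
rewrite -[in RHS](subrK (j.+1%:R * pi) x) nat_case NegzE mulrNz mulNr.
by rewrite mulrA -expr2 sqrr_sign mul1r.
Qed.

Lemma norm_sinD_intpi x (k : int) : `|sin (x + k%:~R * pi)| = `|sin x|.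
Proof.
rewrite -[in LHS](subrK (pi / 2) x) -[in RHS](subrK (pi / 2) x) addrAC !sinDpihalf.
rewrite cosD_intpi normrM.
by case: k => j; rewrite /exprz ?invr_sign normr_sign mul1r.
Qed.

(** The mean value theorem gives [y cos y <= sin y] on [[0, pi / 2]]; applied to
    [y = x / 2] it yields [sin x = 2 sin y cos y >= x cos y ^ 2], where
    [cos y ^ 2 >= 1 / 2] because [cos x >= 0]. *)
Lemma normr_le_2sin x : `|x| <= pi / 2 -> `|x| <= 2 * `|sin x|.
Proof.
wlog x0 : x / 0 <= x => [th|].
  have [/th//|/ltW x0 xpi] := leP 0 x.
  by have := th (- x); rewrite sinN !normrN; apply => //; rewrite oppr_ge0.
have pi0 := pi_gt0 R.
rewrite (ger0_norm x0) => xpi.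
have [->|xN0] := eqVneq x 0; first by rewrite sin0 normr0 mulr0.
have xgt0 : 0 < x by rewrite lt_neqAle eq_sym xN0.
pose y := x / 2.
have y0 : 0 < y by rewrite divr_gt0.
have xE : x = y *+ 2 by rewrite /y -mulr_natr mulfVK.
have sin_y : y * cos y <= sin y.
  have [c] := @MVT R sin cos 0 y y0 (fun z _ => is_derive_sin z)
    (continuous_subspaceT (@continuous_sin R)).
  rewrite in_itv/= => /andP[c0 cy]; rewrite sin0 !subr0 => ->.
  rewrite mulrC ler_pM2r//.
  by rewrite leNgt ltr_cos ?in_itv/= ?(ltW c0) ?(ltW y0)//=; rewrite -?leNgt; lra.
have : 0 <= cos x by rewrite cos_ge0_pihalf//; lra.
have cosy : 0 <= cos y by rewrite cos_ge0_pihalf//; lra.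
have sincos : y * cos y * cos y <= sin y * cos y by rewrite ler_wpM2r.
rewrite {1 3}xE cos_mulr2n sin_mulr2n => cos2.
have ycos : y * (1 / 2) <= y * (cos y ^+ 2).
  rewrite ler_wpM2l ?(ltW y0)//.
  by move: cos2; clear; move: (cos y ^+ 2) => z; lra.
have := ler_norm ((cos y * sin y) *+ 2).
by rewrite -mulrA -expr2 in sincos; lra.
Qed.

Lemma near_intpi x : exists k : int, `|x - k%:~R * pi| <= pi / 2.
Proof.
exists (Num.floor (x / pi + 1 / 2)).
have pi0 := pi_gt0 R.
have /andP[] := floor_itv (x / pi + 1 / 2).
set k := (Num.floor _)%:~R => lo; rewrite intrD -/k => up.
have xE : x = x / pi * pi by rewrite mulfVK ?gt_eqF.
rewrite xE -mulrBl normrM (gtr0_norm pi0) mulrC ler_pM2l//.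
by rewrite ler_norml; apply/andP; split; lra.
Qed.
End Trig.

(** * Fourier inversion on a finite grid *)

Section Fourier.
Variable R : realType.

Definition phase (m : nat) (th : 'I_m -> R) (z : 'cV[int]_m) : R :=
  \sum_i th i * (z i 0)%:~R.

Lemma phaseD m (th : 'I_m -> R) z z' : phase th (z + z') = phase th z + phase th z'.
Proof.
by rewrite -big_split; apply: eq_bigr => i _; rewrite mxE intrD mulrDr.
Qed.

Lemma phaseN m (th : 'I_m -> R) z : phase th (- z) = - phase th z.
Proof. by rewrite -sumrN; apply: eq_bigr => i _; rewrite mxE intrN mulrN. Qed.

Definition grid (m N : nat) (k : {ffun 'I_m -> 'I_N}) (i : 'I_m) : R :=
  2 * pi * (k i)%:R / N%:R.

(** Adding 1 to the [i]-th coordinate permutes the grid and rotates every angle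
    by [2 w], with [w = pi * z i / N].  So the sum [F y] of the cosines
    translated by [y] satisfies [F (y + 2 w) = F y], whereas the addition formula
    gives [F (2 w) + F (- 2 w) = 2 cos (2 w) F 0]; since [w] is not a multiple of
    [pi], [F 0 = 0]. *)
Lemma sum_cos_phase_grid m N (z : 'cV[int]_m) :
  (exists i, 0 < `|z i 0| < N%:Z) ->
  \sum_(k : {ffun 'I_m -> 'I_N}) cos (phase (grid k) z) = 0.
Proof.
move=> [i /andP[zi0 ziN]].
have Npos : 0 < N%:R :> R by rewrite ltr0n; case: (N) ziN zi0 => //; lia.
pose w : R := pi * (z i 0)%:~R / N%:R.
pose F y := \sum_(k : {ffun 'I_m -> 'I_N}) cos (y + phase (grid k) z).
(* [ordS] wraps around, which changes the angle by a multiple of [2 pi]. *)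
pose shift (k : {ffun 'I_m -> 'I_N}) :=
  [ffun j => if j == i then ordS (k j) else k j].
have shift_inj : injective shift.
  move=> k k' /ffunP kk'; apply/ffunP => j; have := kk' j.
  by rewrite !ffunE; case: eqP => // _ /ordS_inj.
have phase_shift k : exists c : int,
    phase (grid (shift k)) z = phase (grid k) z + w *+ 2 + (2 * c)%:~R * pi.
  exists (- ((k i).+1 %/ N)%N%:Z * z i 0).
  rewrite /phase (bigD1 i)//= [in RHS](bigD1 i)//=.
  have -> : \sum_(j | j != i) grid (shift k) j * (z j 0)%:~R =
      \sum_(j | j != i) grid k j * (z j 0)%:~R :> R.
    by apply: eq_bigr => j ji; rewrite /grid ffunE (negPf ji).
  set rest := \sum_(j | _) _.
  rewrite /grid ffunE eqxx /= /w.
  have /(congr1 (fun n => n%:R : R)) := divn_eq (k i).+1 N.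
  rewrite natrD natrM -natr1 => E.
  have -> : ((k i).+1 %% N)%N%:R = (k i)%:R + 1 - ((k i).+1 %/ N)%N%:R * N%:R :> R.
    by rewrite E; ring.
  rewrite !intrM mulrNz -!pmulrn.
  by field; rewrite gt_eqF.
have Fshift y : F y = F (y + w *+ 2).
  rewrite {1}/F (reindex_inj shift_inj); apply: eq_bigr => k _.
  have [c ->] := phase_shift k.
  have -> : y + (phase (grid k) z + w *+ 2 + (2 * c)%:~R * pi) =
    y + w *+ 2 + phase (grid k) z + (2 * c)%:~R * pi by ring.
  by rewrite cosD_intpi -exprz_exp [(-1) ^ 2]sqrrN expr1n exp1rz mul1r.
have Fsum : F (w *+ 2) + F (- (w *+ 2)) = 2 * cos (w *+ 2) * F 0.
  rewrite -big_split mulr_sumr; apply: eq_bigr => k _.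
  by rewrite add0r; move: (w *+ 2) => b /=; rewrite !cosD cosN sinN; ring.
have w_sin : sin w != 0.
  have pi0 := pi_gt0 R.
  have sin_pos (y : R) : 0 < y < 1 -> sin (pi * y) != 0.
    by move=> /andP[y0 y1]; rewrite gt_eqF// sin_gt0_pi//; apply/andP; split; nra.
  have -> : w = pi * ((z i 0)%:~R / N%:R) by rewrite /w mulrA.
  have : 0 < `|(z i 0)%:~R / N%:R : R| < 1.
    rewrite normrM normfV (gtr0_norm Npos) -intr_norm divr_gt0 ?ltr0z//=.
    by rewrite ltr_pdivrMr// mul1r -[N%:R]/(N%:~R) ltr_int.
  case: (lerP 0 ((z i 0)%:~R / N%:R : R)) => [/ger0_norm->|/ltr0_norm->].
    exact: sin_pos.
  by move=> /sin_pos; rewrite mulrN sinN oppr_eq0.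
have F0 : F 0 = \sum_(k : {ffun 'I_m -> 'I_N}) cos (phase (grid k) z).
  by apply: eq_bigr => k _; rewrite add0r.
rewrite -F0; apply/eqP.
have : F 0 * (sin w ^+ 2) = 0.
  move: Fsum; have := Fshift (- (w *+ 2)); rewrite addNr => ->.
  have := Fshift 0; rewrite add0r => <-.
  by rewrite cos_mulr2n cos2sin2; move=> ?; lra.
by move/eqP; rewrite mulf_eq0 sqrf_eq0 (negPf w_sin) orbF.
Qed.

Definition is_sign_intvec (n : nat) (v : 'cV[int]_n) : Prop :=
  forall j, v j 0 = 1 \/ v j 0 = -1.

(** The expansion of the product into a sum over all signings is done one column
    at a time: [2 cos a cos b = cos (a - b) + cos (a + b)] absorbs the first
    column [x] into the target, which becomes [z - x] or [z + x]. *)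
Lemma sum_cos_prod_cos_grid m N n (M : 'M[int]_(m, n)) (z : 'cV[int]_m) :
  (forall v, is_sign_intvec v -> exists i, 0 < `|(z - M *m v) i 0| < N%:Z) ->
  \sum_(k : {ffun 'I_m -> 'I_N})
    cos (phase (grid k) z) * \prod_l cos (phase (grid k) (col l M)) = 0.
Proof.
elim: n M z => [|n IH] M z nosol.
  under eq_bigr do rewrite big_ord0 mulr1.
  apply: sum_cos_phase_grid; have [|i] := nosol 0; first by case.
  by rewrite mulmx0 subr0; exists i.
rewrite -[n.+1]/(1 + n)%N in M nosol *.
pose x := col 0 M; pose M' := rsubmx M.
have xE : x = lsubmx M.
  by apply/matrixP => i j; rewrite !mxE (ord1 j); congr (M _ _); apply/val_inj.
have ext (e : int) v : (e = 1 \/ e = -1) -> is_sign_intvec v ->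
    exists i, 0 < `|(z - e *: x - M' *m v) i 0| < N%:Z.
  move=> esign vsign.
  have [|i] := nosol (col_mx e%:M v : 'cV_(1 + n)).
    move=> j; rewrite mxE; case: splitP => l _; last exact: vsign.
    by rewrite mxE (ord1 l).
  have -> : M *m (col_mx e%:M v) = e *: x + M' *m v.
    by rewrite -[in LHS](hsubmxK M) mul_row_col mul_mx_scalar -xE.
  by rewrite opprD addrA; exists i.
have IHe e (esign : e = 1 \/ e = -1) := IH M' _ (fun v vs => ext e v esign vs).
have := congr2 +%R (IHe 1 (or_introl erefl)) (IHe (-1) (or_intror erefl)).
rewrite addr0 -big_split => S0.
apply: (@mulfI _ 2); rewrite ?pnatr_eq0// mulr0 -[RHS]S0 mulr_sumr.
apply: eq_bigr => k _; rewrite big_ord_recl /=.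
have -> : \prod_(i < n) cos (phase (grid k) (col (lift ord0 i) M)) =
    \prod_(l < n) cos (phase (grid k) (col l M')).
  apply: eq_bigr => l _; congr (cos (phase _ _)).
  by apply/colP => i; rewrite !mxE; congr (M _ _); apply/val_inj.
rewrite -[col ord0 M]/x scale1r scaleN1r opprK !phaseD phaseN cosB cosD.
by ring.
Qed.
End Fourier.

(** * The target vector *)

Lemma subset_of_card (T : finType) (B : {set T}) (k : nat) : (k <= #|B|)%N ->
  exists2 A : {set T}, A \subset B & #|A| = k.
Proof.
rewrite -bin_gt0 -cards_draws card_gt0 => /set0Pn[A].
by rewrite inE => /andP[AB /eqP Ak]; exists A.
Qed.

(** Start from the indicator of the prescribed odd set [O].  If its size falls
    short of [T], turn entries 0 outside [O] into 2; if it exceeds [T], turn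
    entries 1 into -1. *)
Lemma small_vec_of_parity m (O : {set 'I_m}) (T : nat) :
  (T <= m)%N -> odd T = odd #|O| ->
  exists2 z : 'cV[int]_m,
    (forall i, `|z i 0| <= 2 /\ exists w, z i 0 = (i \in O)%:R + w *+ 2) &
    \sum_i z i 0 = T%:Z.
Proof.
move=> Tm ToddO.
have card_sum (A : {set 'I_m}) : \sum_i (i \in A)%:R = #|A|%:Z :> int.
  rewrite -sum1_card -natz natr_sum [RHS]big_mkcond.
  by apply: eq_bigr => i _; case: (i \in A).
have [OT|TO] := leqP #|O| T.
- have [|A /fintype.subsetP AO Acard] := @subset_of_card _ (~: O) (T - #|O|)./2.
    by have := cardsC O; rewrite card_ord; lia.
  exists (\col_i ((i \in O)%:R + (i \in A)%:R *+ 2)).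
    move=> i; rewrite mxE; split; last by eexists.
    have [iA|] := boolP (i \in A); last by case: (i \in O).
    by have := AO _ iA; rewrite inE => /negPf ->.
  under eq_bigr do rewrite mxE.
  rewrite big_split /= sumrMnl !card_sum Acard mulr2n; lia.
- have [|A /fintype.subsetP AO Acard] := @subset_of_card _ O (#|O| - T)./2.
    by lia.
  exists (\col_i ((i \in O)%:R + (- (i \in A)%:R) *+ 2)).
    move=> i; rewrite mxE; split; last by eexists.
    have [iA|] := boolP (i \in A); last by case: (i \in O).
    by rewrite AO.
  under eq_bigr do rewrite mxE.
  rewrite big_split /= sumrMnl sumrN !card_sum Acard mulr2n; lia.
Qed.

Definition int_mx (m n : nat) (M : 'M[bool]_(m, n)) : 'M[int]_(m, n) :=
  map_mx (fun b : bool => b%:R) M.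

Lemma sum_sparse_col m t (x : 'cV[bool]_m) : x \in sparse_vecs m t ->
  \sum_i int_mx x i 0 = t%:Z.
Proof.
rewrite inE => /eqP <-; rewrite -sum1_card -natz natr_sum [RHS]big_mkcond.
by apply: eq_bigr => i _; rewrite mxE inE; case: (x i 0).
Qed.

(** Agreement of all parities with the column sum, whose total is [t * n], makes
    [z] congruent to it modulo twice the lattice of vectors with coordinate sum
    in [t Z].  A coordinate sum of 0 or [t], rather than a larger multiple of
    [t], keeps [<th, z>] as close to [pi Z] as the phases of sparse vectors. *)
Lemma exists_target m n t (M : 'M[bool]_(m, n)) : (t <= m)%N ->
  (forall l, col l M \in sparse_vecs m t) ->
  exists z w : 'cV[int]_m,
    [/\ forall i, `|z i 0| <= 2,
        \sum_i z i 0 = t%:Z * (odd n)%:R &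
        z + \sum_l col l (int_mx M) = w *+ 2].
Proof.
move=> tm colM.
pose u : 'cV[int]_m := \sum_l col l (int_mx M).
have u_sum : \sum_i u i 0 = (t * n)%N%:Z.
  under eq_bigr do rewrite summxE.
  rewrite exchange_big/= (eq_bigr (fun=> t%:Z)) => [|l _].
    by rewrite sumr_const card_ord; lia.
  rewrite -(sum_sparse_col (colM l)); apply: eq_bigr => i _.
  by rewrite !mxE.
pose O := [set i | odd (absz (u i 0))]%SET.
have O_odd : odd (t * odd n) = odd #|O|.
  have : odd (absz (\sum_i u i 0)) = odd #|O|.
    rewrite -sum1_card [in RHS]big_mkcond /=.
    elim/big_ind2 : _ => // [a b c d|i _]; first lia.
    by rewrite inE; case: ifP => // ->.
  by rewrite u_sum; lia.
have [|z zP zsum] := @small_vec_of_parity m O (t * odd n) _ O_odd.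
  by case: odd; lia.
have zu i : exists w, z i 0 + u i 0 = w *+ 2.
  have [_ [w ->]] := zP i.
  exists (divz ((i \in O)%:R + u i 0 + w *+ 2) 2).
  rewrite inE !mulr2n; case E : (odd _) => /=; lia.
have {zu}/boolp.choice[w wP] := zu.
exists z, (\col_i w i); split => [i||]; first by have [] := zP i.
  by rewrite zsum; case: odd; lia.
by apply/colP => i; rewrite mulr2n !mxE -/u wP mulr2n.
Qed.

(** * Sign of the summand near multiples of pi *)

Section Core.
Variable R : realType.

(** The phase depends on the common part [th0] only through the sum of [z], a
    multiple of [t]; this is why [t * th0], and not [th0], has to be close to a
    multiple of [pi]. *)
Lemma phase_lift m (t : nat) (th eta : 'I_m -> R) (th0 s : R) (k : 'I_m -> int)
    (r q : int) (z : 'cV[int]_m) :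
  (forall i, th i = th0 + eta i + (k i)%:~R * pi) ->
  t%:R * th0 = s + r%:~R * pi -> \sum_i z i 0 = t%:Z * q ->
  phase th z =
    (q%:~R * s + phase eta z) + (r * q + \sum_i k i * z i 0)%:~R * pi.
Proof.
move=> thE sE zsum.
have -> : phase th z = th0 * (\sum_i z i 0)%:~R + phase eta z +
    (\sum_i k i * z i 0)%:~R * pi.
  rewrite !rmorph_sum mulr_sumr mulr_suml -!big_split; apply: eq_bigr => i _.
  by rewrite thE /= intrM; ring.
rewrite zsum intrD !intrM -pmulrn mulrA [th0 * _]mulrC sE.
by ring.
Qed.

Lemma normr_phase_le m (eta : 'I_m -> R) (z : 'cV[int]_m) (b : nat) :
  (forall i, `|z i 0| <= b%:Z) ->
  `|phase eta z| <= b%:R * \sum_i `|eta i|.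
Proof.
move=> zb; rewrite mulr_sumr; apply: le_trans (ler_norm_sum _ _ _) _.
apply: ler_sum => i _; rewrite normrM mulrC ler_wpM2r//.
by rewrite -intr_norm -[b%:R]/(b%:~R) ler_int.
Qed.

(** Each factor is a power of [-1] times the cosine of an angle in
    [[- pi / 2, pi / 2]].  The exponents add up to
    [r * (n + odd n) + <k, z + sum of the columns>], and both terms are even. *)
Lemma cos_prod_cos_ge0 m n (t : nat) (M : 'M[int]_(m, n)) (z w : 'cV[int]_m)
    (th eta : 'I_m -> R) (th0 s : R) (k : 'I_m -> int) (r : int) :
  (forall i, th i = th0 + eta i + (k i)%:~R * pi) ->
  t%:R * th0 = s + r%:~R * pi ->
  `|s| + 2 * \sum_i `|eta i| <= pi / 2 ->
  (forall i l, `|M i l| <= 1) -> (forall l, \sum_i M i l = t%:Z) ->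
  (forall i, `|z i 0| <= 2) -> \sum_i z i 0 = t%:Z * (odd n)%:R ->
  z + \sum_l col l M = w *+ 2 ->
  0 <= cos (phase th z) * \prod_l cos (phase th (col l M)).
Proof.
move=> thE sE small M1 Msum z2 zsum zw.
have colE l : cos (phase th (col l M)) =
    (-1) ^ (r + \sum_i k i * M i l) * cos (s + phase eta (col l M)).
  rewrite (phase_lift (q := 1) thE sE); last first.
    by under eq_bigr do rewrite mxE; rewrite Msum mulr1.
  by rewrite cosD_intpi mulr1 mul1r; under eq_bigr do rewrite mxE.
under eq_bigr do rewrite colE.
rewrite big_split /= (phase_lift thE sE zsum) cosD_intpi mulrACA.
have m1N0 : -1 != 0 :> R by rewrite oppr_eq0 oner_eq0.
rewrite -(big_morph (fun e : int => (-1) ^ e : R)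
  (fun a b => expfzDr a b m1N0) (expr0z _)) -expfzDr//.
have -> : r * (odd n)%:R + \sum_i k i * z i 0 +
    \sum_(l < n) (r + \sum_i k i * M i l) =
    2 * (r * (uphalf n)%:Z + \sum_i k i * w i 0).
  have kw : \sum_i k i * z i 0 + \sum_(l < n) \sum_i k i * M i l =
      2 * \sum_i k i * w i 0.
    rewrite exchange_big -big_split mulr_sumr; apply: eq_bigr => i _ /=.
    have /colP/(_ i) := zw; rewrite mulr2n !mxE summxE => zwi.
    have -> : \sum_(l < n) k i * M i l = k i * \sum_(l < n) col l M i 0.
      by rewrite mulr_sumr; apply: eq_bigr => l _; rewrite mxE.
    by rewrite -mulrDr zwi; ring.
  rewrite big_split sumr_const card_ord /= mulrDr -kw.
  have -> : 2 * (r * (uphalf n)%:Z) = r * (odd n)%:R + r *+ n.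
    rewrite -[r *+ n]mulr_natr natz -mulrDr mulrCA; congr (_ * _).
    by case E : (odd n) => /=; lia.
  by ring.
rewrite -exprz_exp [(-1) ^ 2]sqrrN expr1n exp1rz mul1r.
have cos_ge0 x : `|x| <= pi / 2 -> 0 <= cos x :> R.
  by rewrite ler_norml => ?; exact: cos_ge0_pihalf.
have eta0 : 0 <= \sum_i `|eta i| by apply: sumr_ge0.
apply: mulr_ge0; last apply: prodr_ge0 => l _; apply: cos_ge0.
- apply: le_trans (ler_normD _ _) _.
  have := @normr_phase_le _ eta z 2 z2.
  have : `|((odd n)%:R : int)%:~R * s| <= `|s|.
    by case: odd; rewrite ?mul1r ?mul0r ?normr0.
  by lra.
- apply: le_trans (ler_normD _ _) _.
  have := @normr_phase_le _ eta (col l M) 1; rewrite mul1r => phase_le.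
  have {phase_le} : `|phase eta (col l M)| <= \sum_i `|eta i|.
    by apply: phase_le => i; rewrite mxE; exact: M1.
  by lra.
Qed.
End Core.

(** * Averages over sparse vectors *)

Lemma exists_le_of_sum_le (R : realDomainType) (I : finType) (A : {set I})
    (f : I -> R) (c : R) :
  (0 < #|A|)%N -> \sum_(i in A) f i <= c * #|A|%:R ->
  exists2 i, i \in A & f i <= c.
Proof.
move=> /card_gt0P[i0 i0A] le_c.
have [/exists_inP[i iA fi]|/exists_inPn no_i] := boolP [exists i in A, f i <= c].
  by exists i.
have : \sum_(i in A) c < \sum_(i in A) f i.
  apply: ltr_sum => [|i iA]; last by rewrite ltNge no_i.
  by apply/hasP; exists i0; rewrite ?mem_index_enum.
by rewrite sumr_const -mulr_natr ltNge le_c.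
Qed.

Section Sparse.
Variable R : realType.
Variables m t : nat.
Implicit Types (x : 'cV[bool]_m) (th : 'I_m -> R).

Let S := sparse_vecs m t.

Lemma row_perm_sparse (s : 'S_m) x : (row_perm s x \in S) = (x \in S).
Proof.
rewrite !inE; congr (_ == _); rewrite -[RHS](card_preimset _ (@perm_inj _ s)).
by apply: eq_card => i; rewrite !inE mxE.
Qed.

Let occ x (i j : 'I_m) : R := (x i 0 && ~~ x j 0)%:R.

Lemma sum_occ x : x \in S -> \sum_i \sum_j occ x i j = t%:R * (m%:R - t%:R).
Proof.
rewrite inE => /eqP <-; rewrite -sum1_card natr_sum.
have -> : \sum_(i in [set i | x i 0]%SET) 1%:R = \sum_i (x i 0)%:R :> R.
  by rewrite big_mkcond; apply: eq_bigr => i _; rewrite inE; case: (x i 0).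
have -> : m%:R = \sum_(i < m) 1 :> R by rewrite sumr_const card_ord.
rewrite -sumrB big_distrlr; apply: eq_bigr => i _; apply: eq_bigr => j _ /=.
by rewrite /occ; case: (x i 0); case: (x j 0); rewrite /= ?mul1r ?mul0r ?subrr ?subr0.
Qed.

Lemma sum_occ_perm (s : 'S_m) (g : 'cV[bool]_m -> R) i j :
  \sum_(x in S) occ x (s i) (s j) * g (row_perm s x) =
  \sum_(x in S) occ x i j * g x.
Proof.
have rp_inj : injective (@row_perm bool m 1 s).
  by move=> x y /(congr1 (row_perm s^-1%g)); rewrite -!row_permM mulVg !row_perm1.
rewrite [RHS](reindex_inj rp_inj); apply: eq_big => [x|x _].
  by rewrite row_perm_sparse.
by rewrite /occ !mxE.
Qed.

(** Permutations of the coordinates act doubly transitively. *)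
Lemma sum_occ_const (i j i' j' : 'I_m) : i != j -> i' != j' ->
  \sum_(x in S) occ x i j = \sum_(x in S) occ x i' j'.
Proof.
move=> ij ij'.
have perm_occ (s : 'S_m) k l :
    \sum_(x in S) occ x (s k) (s l) = \sum_(x in S) occ x k l.
  have := sum_occ_perm s (fun=> 1) k l.
  by under eq_bigr do rewrite mulr1; under [in X in _ = X]eq_bigr do rewrite mulr1.
rewrite -(perm_occ (tperm i i')) tpermL.
set j1 := tperm i i' j.
have j1i' : j1 != i'.
  by rewrite -[X in _ != X](tpermL i i') (inj_eq perm_inj) eq_sym.
by rewrite -(perm_occ (tperm j1 j')) tpermL tpermD// eq_sym.
Qed.

Lemma norm_sinB_le (u v : R) : `|sin (u - v)| <= `|sin u| + `|sin v|.
Proof.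
rewrite sinB; apply: le_trans (ler_normB _ _) _; rewrite !normrM.
have := cos_max u; have := cos_max v.
have := normr_ge0 (sin u); have := normr_ge0 (sin v).
by nra.
Qed.

Definition abs_sin th x : R := `|sin (phase th (int_mx x))|.

Lemma phase_swap th x (i j : 'I_m) : x i 0 -> ~~ x j 0 ->
  phase th (int_mx x) - phase th (int_mx (row_perm (tperm i j) x)) =
  th i - th j.
Proof.
move=> xi /negPf xj.
have ij : j != i by apply: contraFneq xj => ->.
rewrite /phase -sumrB (bigD1 i)//= (bigD1 j)//= big1 => [|k /andP[ki kj]].
  by rewrite !mxE tpermL tpermR xi xj /=; ring.
by rewrite !mxE tpermD 1?eq_sym// subrr.
Qed.

(** If [x i = 1] and [x j = 0], exchanging these two entries changes the phase by
    [th i - th j], so [|sin (th i - th j)|] is bounded by the sum of the values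
    of [abs_sin] at the two vectors.  Summing over all such triples [(x, i, j)],
    each ordered pair [i != j] occurs equally often ([F] times), each sparse
    vector occurs [t (m - t)] times in either role, and counting the triples in
    two ways relates [F] to the number of sparse vectors. *)
Lemma sum_abs_sinB_le th : (0 < t < m)%N ->
  (\sum_i \sum_j `|sin (th i - th j)|) * #|S|%:R <=
  2 * m%:R ^+ 2 * \sum_(x in S) abs_sin th x.
Proof.
move=> /andP[t0 tm].
pose b i j := `|sin (th i - th j)|; pose A := \sum_(x in S) abs_sin th x.
rewrite -/A; set B := \sum_i _.
have m_gt0 : (0 < m)%N by exact: leq_ltn_trans tm.
pose i0 : 'I_m := Ordinal m_gt0; pose i1 : 'I_m := Ordinal (leq_ltn_trans t0 tm).
pose F := \sum_(x in S) occ x i0 i1.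
have FE i j : \sum_(x in S) occ x i j = (i != j)%:R * F.
  have [->|ij] := eqVneq i j; last by rewrite mul1r; exact: sum_occ_const.
  by rewrite mul0r big1// => x _; rewrite /occ andbN.
have F_count : F * (m%:R * (m%:R - 1)) = t%:R * (m%:R - t%:R) * #|S|%:R.
  have <- : \sum_(x in S) \sum_i \sum_j occ x i j = t%:R * (m%:R - t%:R) * #|S|%:R.
    rewrite (eq_bigr (fun=> t%:R * (m%:R - t%:R))) => [|x]; last exact: sum_occ.
    by rewrite sumr_const mulr_natr.
  rewrite exchange_big /=.
  rewrite [RHS](eq_bigr (fun=> (m%:R - 1) * F)) => [|i _].
    by rewrite sumr_const card_ord -[RHS]mulr_natr; ring.
  rewrite exchange_big /= (eq_bigr (fun j => (i != j)%:R * F)) => [|j _].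
    rewrite -mulr_suml; congr (_ * _); rewrite (bigD1 i)//= eqxx add0r.
    rewrite (eq_bigr (fun=> 1)) => [|j ji]; last by rewrite eq_sym ji.
    by rewrite sumr_const cardC1 card_ord -subn1 natrB.
  exact: FE.
have A_bound : B * F <= 2 * (t%:R * (m%:R - t%:R)) * A.
  have -> : B * F = \sum_i \sum_j \sum_(x in S) occ x i j * b i j.
    rewrite mulr_suml; apply: eq_bigr => i _.
    rewrite mulr_suml; apply: eq_bigr => j _; rewrite -mulr_suml FE mulrC /b.
    by have [->|_] := eqVneq i j; rewrite ?subrr ?sin0 ?normr0 ?mulr0// mul1r.
  have -> : 2 * (t%:R * (m%:R - t%:R)) * A =
      \sum_i \sum_j \sum_(x in S) (occ x i j + occ x j i) * abs_sin th x.
    transitivity (\sum_(x in S) \sum_i \sum_j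
        (occ x i j + occ x j i) * abs_sin th x); last first.
      rewrite exchange_big; apply: eq_bigr => i _ /=.
      by rewrite exchange_big.
    rewrite mulr_sumr; apply: eq_bigr => x xS.
    under [RHS]eq_bigr do rewrite -mulr_suml big_split.
    rewrite -mulr_suml big_split /= [X in _ = (_ + X) * _]exchange_big /= !sum_occ//.
    by ring.
  apply: ler_sum => i _; apply: ler_sum => j _.
  have -> : \sum_(x in S) (occ x i j + occ x j i) * abs_sin th x =
      \sum_(x in S) occ x i j *
        (abs_sin th x + abs_sin th (row_perm (tperm i j) x)).
    under [RHS]eq_bigr do rewrite mulrDr.
    under [LHS]eq_bigr do rewrite mulrDl.
    rewrite !big_split; congr (_ + _).
    by rewrite -(sum_occ_perm (tperm i j)) tpermL tpermR.
  apply: ler_sum => x xS; rewrite /occ.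
  have [/andP[xi xj]|_] := boolP (_ && _); last by rewrite !mul0r.
  by rewrite !mul1r /b -(phase_swap th xi xj); exact: norm_sinB_le.
have B0 : 0 <= B by apply: sumr_ge0 => i _; apply: sumr_ge0.
have A0 : 0 <= A by apply: sumr_ge0 => x _; exact: normr_ge0.
have t0R : 1 <= t%:R :> R by rewrite ler1n.
have tmR : t%:R + 1 <= m%:R :> R by rewrite natr1 ler_nat.
have tmt : 0 < t%:R * (m%:R - t%:R) :> R by apply: mulr_gt0; lra.
rewrite -(ler_pM2l tmt).
have -> : t%:R * (m%:R - t%:R) * (B * #|S|%:R) = m%:R * (m%:R - 1) * (B * F).
  by rewrite mulrCA -F_count; ring.
apply: (@le_trans _ _ (m%:R * m%:R * (B * F))).
  apply: ler_wpM2r; last by apply: ler_wpM2l; lra.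
  by apply: mulr_ge0 => //; apply: sumr_ge0.
have -> : t%:R * (m%:R - t%:R) * (2 * m%:R ^+ 2 * A) =
    m%:R * m%:R * (2 * (t%:R * (m%:R - t%:R)) * A) by ring.
by apply: ler_wpM2l => //; apply: mulr_ge0.
Qed.

Lemma norm_sin_phase_le (eta : 'I_m -> R) x :
  `|sin (phase eta (int_mx x))| <= \sum_i `|sin (eta i)|.
Proof.
rewrite /phase; elim/big_ind2 : _ => [|u u' v v' uu vv|i _].
- by rewrite sin0 normr0.
- rewrite -[v']opprK; apply: le_trans (norm_sinB_le _ _) _.
  by rewrite sinN normrN lerD.
- by rewrite mxE; case: (x i 0); rewrite ?mulr1 ?mulr0 ?sin0 ?normr0.
Qed.

(** [th0] is a coordinate of [th] from which the others deviate least in total,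
    modulo [pi]; it exists by averaging [sum_abs_sinB_le].  To control
    [t * th0] modulo [pi], pick one sparse vector [x] whose phase is at least as
    close to [pi Z] as the average: that phase is [t * th0] up to the small
    deviations [eta]. *)
Lemma lift_of_abs_sin_le th (rho : R) : (0 < t < m)%N -> (0 < #|S|)%N ->
  0 <= rho -> \sum_(x in S) abs_sin th x <= rho * #|S|%:R ->
  exists (th0 : R) (eta : 'I_m -> R) (k : 'I_m -> int) (s : R) (r : int),
    [/\ forall i, th i = th0 + eta i + (k i)%:~R * pi,
        t%:R * th0 = s + r%:~R * pi &
        `|s| + 2 * \sum_i `|eta i| <= 18 * m%:R * rho].
Proof.
move=> tm S0 rho0 small; have m_gt0 : (0 < m)%N by lia.
have [j jsum] : exists j, \sum_i `|sin (th i - th j)| <= 2 * m%:R * rho.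
  have [||j _ jP] := @exists_le_of_sum_le R _ [set: 'I_m]
    (fun j => \sum_i `|sin (th i - th j)|) (2 * m%:R * rho).
  - by rewrite cardsT card_ord.
  - rewrite cardsT card_ord; under eq_bigl do rewrite inE.
    rewrite exchange_big /= -(@ler_pM2r _ #|S|%:R) ?ltr0n//.
    apply: le_trans (sum_abs_sinB_le th tm) _.
    have -> : 2 * m%:R * rho * m%:R * #|S|%:R =
      2 * m%:R ^+ 2 * (rho * #|S|%:R) by ring.
    by apply: ler_wpM2l => //; apply: mulr_ge0.
  - by exists j.
have [x xS xsin] := exists_le_of_sum_le S0 small.
have /boolp.choice[k kP] := fun i => near_intpi (th i - th j).
pose eta i := th i - th j - (k i)%:~R * pi.
have [r rP] := near_intpi (t%:R * th j).
pose s := t%:R * th j - r%:~R * pi.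
have thE i : th i = th j + eta i + (k i)%:~R * pi by rewrite /eta; ring.
have sE : t%:R * th j = s + r%:~R * pi by rewrite /s; ring.
have sin_eta i : `|sin (eta i)| = `|sin (th i - th j)|.
  rewrite -[RHS](congr1 (fun y => `|sin y|) (subrK ((k i)%:~R * pi) _)).
  by rewrite norm_sinD_intpi.
have eta_sum : \sum_i `|eta i| <= 2 * \sum_i `|sin (eta i)|.
  by rewrite mulr_sumr; apply: ler_sum => i _; apply: normr_le_2sin; exact: kP.
have sin_eta_sum : \sum_i `|sin (eta i)| <= 2 * m%:R * rho.
  by under eq_bigr do rewrite sin_eta.
have sin_s : `|sin s| <= rho + 2 * m%:R * rho.
  have := xsin; rewrite /abs_sin (phase_lift (q := 1) thE sE); last first.
    by rewrite mulr1; exact: sum_sparse_col.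
  rewrite norm_sinD_intpi mul1r => sin_le.
  rewrite -[s](addrK (phase eta (int_mx x))).
  apply: le_trans (norm_sinB_le _ _) _; apply: lerD => //.
  exact: le_trans (norm_sin_phase_le _ _) _.
have s_le := normr_le_2sin rP; rewrite -/s in s_le.
exists (th j), eta, k, s, r; split => //.
have : rho <= m%:R * rho by rewrite ler_peMl// ler1n.
by lra.
Qed.

(** With [s = |sin u|], [|cos u| <= (1 + cos u ^ 2) / 2 = 1 - s ^ 2 / 2] and
    [s ^ 2 >= 2 rho s - rho ^ 2]; the resulting bound is linear in [s] and can be
    averaged. *)
Lemma sum_norm_cos_le th (rho : R) : 0 <= rho ->
  rho * #|S|%:R <= \sum_(x in S) abs_sin th x ->
  \sum_(x in S) `|cos (phase th (int_mx x))| <= (1 - rho ^+ 2 / 2) * #|S|%:R.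
Proof.
move=> rho0 big_sin.
have cos_le x : `|cos (phase th (int_mx x))| <=
    1 + rho ^+ 2 / 2 - rho * abs_sin th x.
  rewrite /abs_sin; set u := phase _ _.
  have := cos2Dsin2 u.
  rewrite -(real_normK (num_real (cos u))) -(real_normK (num_real (sin u))).
  have := sqr_ge0 (1 - `|cos u|); have := sqr_ge0 (rho - `|sin u|).
  by nra.
apply: le_trans (ler_sum _ (fun x _ => cos_le x)) _.
rewrite sumrB sumr_const -mulr_natr -mulr_sumr.
have : rho * (rho * #|S|%:R) <= rho * \sum_(x in S) abs_sin th x.
  exact: ler_wpM2l.
by lra.
Qed.

Lemma sparse_vecs_gt0 : (t <= m)%N -> (0 < #|S|)%N.
Proof.
move=> tm; have [|A _ At] := @subset_of_card _ [set: 'I_m] t.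
  by rewrite cardsT card_ord.
apply/card_gt0P; exists (\col_i (i \in A)); rewrite inE -[X in _ == X]At.
by apply/eqP/eq_card => i; rewrite inE mxE.
Qed.
End Sparse.

(** * From the frequency sum to the discrepancy *)

Section Disc.
Variable R : realType.

Lemma disc_le_of_intvec m n (M : 'M[bool]_(m, n)) (v : 'cV[int]_n) (b : nat) :
  is_sign_intvec v -> (forall i, `|(int_mx M *m v) i 0| <= b%:Z) ->
  disc (real_mx R M) <= b%:R.
Proof.
move=> vsign Mv_le; pose vR : 'cV[R]_n := map_mx intr v.
have vRsign : is_sign_vec vR.
  by move=> j; rewrite mxE; case: (vsign j) => ->; rewrite ?intrN; [left|right].
apply: le_trans ((discP (real_mx R M)).2 vR vRsign) _.
have -> : real_mx R M *m vR = map_mx intr (int_mx M *m v).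
  rewrite map_mxM; congr (_ *m _).
  by apply/matrixP => i j; rewrite !mxE; case: (M i j).
rewrite [leLHS]mx_normrE; apply: bigmax_le => // -[i j] _ /=.
by rewrite mxE (ord1 j) -intr_norm -[b%:R]/(b%:~R) ler_int.
Qed.

Lemma disc_const_mx m n (b : bool) :
  disc (real_mx R (const_mx b : 'M[bool]_(m, n))) <= 2.
Proof.
pose v : 'cV[int]_n := \col_j (-1) ^+ j.
have vsign : is_sign_intvec v.
  by move=> j; rewrite mxE -signr_odd; case: odd; [right|left].
apply: (@disc_le_of_intvec _ _ _ v 2) => // i; rewrite mxE.
under eq_bigr do rewrite !mxE; rewrite -mulr_sumr.
have -> : \sum_(j < n) (-1) ^+ j = (odd n)%:R :> int.
  elim: n {v vsign} => [|n IH]; first by rewrite big_ord0.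
  by rewrite big_ord_recr /= IH -signr_odd; case: odd.
by case: b; case: odd.
Qed.

(** The mean of [abs_sin] over the sparse vectors is at most [rho], with the
    denominator cleared. *)
Definition small_sin m t rho (th : 'I_m -> R) :=
  \sum_(x in sparse_vecs m t) abs_sin th x <= rho * #|sparse_vecs m t|%:R.

(** If every signing missed the target, the sum of [G] over the grid would
    vanish; but the frequencies in [small_sin] contribute at least [G 0 = 1], and
    the others more than -1. *)
Lemma disc_le2_of_tail m n t (M : 'M[bool]_(m, n)) (rho : R) :
  (0 < t < m)%N -> 0 <= rho -> 18 * m%:R * rho <= 1 ->
  (forall l, col l M \in sparse_vecs m t) ->
  \sum_(k : {ffun 'I_m -> 'I_n.+3} | ~~ small_sin t rho (grid R k))
    \prod_l `|cos (phase (grid R k) (int_mx (col l M)))| < 1 ->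
  disc (real_mx R M) <= 2.
Proof.
move=> tm rho0 rho_small colM tail; apply/negPn/negP => disc_gt.
have [t0 t_le] : (0 < t)%N /\ (t <= m)%N by lia.
have [z [w [z2 zsum zw]]] := exists_target t_le colM.
pose G (k : {ffun 'I_m -> 'I_n.+3}) := cos (phase (grid R k) z) *
  \prod_l cos (phase (grid R k) (col l (int_mx M))).
have M01 i l : 0 <= int_mx M i l <= 1 by rewrite mxE; case: (M i l).
have Gsum : \sum_k G k = 0.
  apply: sum_cos_prod_cos_grid => v vsign.
  have [i zi] : exists i, (z - int_mx M *m v) i 0 != 0.
    apply/existsP; apply: contraNT disc_gt => /existsPn z_eq.
    apply: (@disc_le_of_intvec _ _ _ v 2) => // i.
    have /negPn := z_eq i; rewrite !mxE subr_eq0 => /eqP <-.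
    exact: z2.
  exists i; rewrite normr_gt0 zi 2!mxE /=.
  have Mv : `|(int_mx M *m v) i 0| <= n%:Z.
    rewrite mxE; apply: le_trans (ler_norm_sum _ _ _) _.
    rewrite -[n in n%:Z](card_ord n) -sum1_card -natz natr_sum; apply: ler_sum => j _.
    have := M01 i j; rewrite normrM => /andP[/ger0_norm -> M1].
    by case: (vsign j) => ->; rewrite ?normrN normr1 mulr1.
  by move: Mv (z2 i); clear; move: (fun_of_matrix (_ *m _) i 0) (z i 0) => a b; lia.
have G_core k : small_sin t rho (grid R k) -> 0 <= G k.
  move=> small.
  have [th0 [eta [e [s [r [thE sE s_le]]]]]] :=
    lift_of_abs_sin_le tm (sparse_vecs_gt0 t_le) rho0 small.
  apply: (cos_prod_cos_ge0 thE sE _ _ _ z2 zsum zw).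
  - apply: le_trans s_le _; have := pi_ge2 R; lra.
  - by move=> i l; have := M01 i l; lia.
  - move=> l; rewrite -(sum_sparse_col (colM l)).
    by apply: eq_bigr => i _; rewrite !mxE.
pose k0 : {ffun 'I_m -> 'I_n.+3} := [ffun=> ord0].
have phase0 y : phase (grid R k0) y = 0.
  by rewrite /phase big1// => i _; rewrite /grid ffunE mulr0 !mul0r.
have k0_small : small_sin t rho (grid R k0).
  rewrite /small_sin big1 => [|x _]; first exact: mulr_ge0.
  by rewrite /abs_sin phase0 sin0 normr0.
have : 1 <= \sum_(k | small_sin t rho (grid R k)) G k.
  rewrite (bigD1 k0)//= {1}/G phase0 cos0 mul1r big1 => [|l _]; last first.
    by rewrite phase0 cos0.
  by rewrite lerDl; apply: sumr_ge0 => k /andP[+ _]; exact: G_core.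
have : `|\sum_(k | ~~ small_sin t rho (grid R k)) G k| < 1.
  apply: le_lt_trans (ler_norm_sum _ _ _) (le_lt_trans _ tail).
  apply: ler_sum => k _; rewrite /G normrM normr_prod.
  rewrite -[leRHS]mul1r ler_pM// ?prodr_ge0 ?cos_max//.
  apply: ler_prod => l _; rewrite normr_ge0 /=.
  have -> // : col l (int_mx M) = int_mx (col l M).
  by apply/colP => i; rewrite !mxE.
move: Gsum; rewrite (bigID (fun k => small_sin t rho (grid R k))) /=.
rewrite ltr_norml => ? /andP[? ?] ?; lra.
Qed.
End Disc.

(** * Probability of a bad matrix *)

Section Law.
Variable R : realType.

Definition col_law m t (x : 'cV[bool]_m) : R :=
  (x \in sparse_vecs m t)%:R / #|sparse_vecs m t|%:R.

Lemma measure_bigsetU_le d (T : measurableType d) (mu : {measure set T -> \bar R})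
    (I : finType) (Q : pred I) (E : I -> set T) :
  (forall i, measurable (E i)) ->
  (mu (\big[setU/set0]_(i | Q i) E i) <= \sum_(i | Q i) mu (E i))%E.
Proof.
move=> mE.
suff [] : measurable (\big[setU/set0]_(i | Q i) E i) /\
  (mu (\big[setU/set0]_(i | Q i) E i) <= \sum_(i | Q i) mu (E i))%E by [].
elim/big_rec2 : _ => [|i y A _ [mA le_y]]; first by rewrite measure0.
split; first exact: measurableU.
by apply: le_trans (measureU2 _ _ _) _ => //; rewrite leeD2l.
Qed.

(** Independence and uniformity of the columns give every single matrix the
    product of its column laws as probability; a union bound over the finitely
    many bad matrices follows. *)
Lemma prob_notin_ge d (T : measurableType d) (P : probability T R) (m n t : nat)
    (M : T -> 'M[bool]_(m, n)) (bad : pred 'M[bool]_(m, n)) :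
  random_sparse_mx P t M ->
  ((1 - \sum_(A | bad A) \prod_j col_law t (col j A))%:E
    <= P [set w | ~~ bad (M w)])%E.
Proof.
move=> [mM indep unif].
have M_eqE (A : 'M[bool]_(m, n)) : [set w | M w = A] =
    \big[setI/setT]_(p : 'I_m * 'I_n) [set w | M w p.1 p.2 = A p.1 p.2].
  apply/seteqP; split=> [w /= MA|w].
    by rewrite -bigcap_seq => p _ /=; rewrite MA.
  rewrite -bigcap_seq => Mw; apply/matrixP => i j.
  by apply: (Mw (i, j)) => /=; rewrite mem_index_enum.
have mM_eq A : measurable [set w | M w = A].
  rewrite M_eqE; apply: bigsetI_measurable => p _.
  by have := mM p.1 p.2 measurableT [set A p.1 p.2] I; rewrite setTI.
have PM_eq A : P [set w | M w = A] = (\prod_j col_law t (col j A))%:E.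
  have := indep [set: 'I_n]%SET (fun j => [set col j A]).
  have -> : \bigcap_(j in [set` [set: 'I_n]%SET])
      ((fun w => col j (M w)) @^-1` [set col j A]) = [set w | M w = A].
    apply/seteqP; split=> [w /= MA|w /= MA j _ /=]; last by rewrite MA.
    apply/matrixP => i j; have /= /colP/(_ i) := MA j (finset.in_setT j).
    by rewrite !mxE.
  move=> ->; rewrite -prodEFin; apply: eq_big => [j|j _]; first by rewrite inE.
  exact: unif.
have badE : [set w | bad (M w)] = \big[setU/set0]_(A | bad A) [set w | M w = A].
  rewrite -bigcup_seq_cond; apply/seteqP; split=> w /=.
    by move=> bM; exists (M w) => //=; rewrite mem_index_enum.
  by move=> [A /= /andP[_ badA] ->].
have mbad : measurable [set w | bad (M w)].
  by rewrite badE; apply: bigsetU_measurable => A _.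
have -> : [set w | ~~ bad (M w)] = ~` [set w | bad (M w)].
  by apply/seteqP; split => w /= /negP.
rewrite [leRHS]probability_setC// EFinB leeB// badE.
rewrite -sumEFin; apply: le_trans (measure_bigsetU_le _ _ mM_eq) _.
by apply: lee_sum => A _; rewrite -PM_eq.
Qed.

Lemma sum_prod_col m n (F : 'cV[bool]_m -> R) :
  \sum_(A : 'M[bool]_(m, n)) \prod_j F (col j A) = (\sum_x F x) ^+ n.
Proof.
rewrite -[in RHS](card_ord n) -prodr_const bigA_distr_bigA /=.
pose toM (f : {ffun 'I_n -> 'cV[bool]_m}) := \matrix_(i, j) f j i 0.
rewrite (reindex toM) /=.
  apply: eq_bigr => f _; apply: eq_bigr => j _; congr F.
  by apply/colP => i; rewrite !mxE.
exists (fun A => [ffun j => col j A]) => [f _|A _].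
  by apply/ffunP => j; rewrite ffunE; apply/colP => i; rewrite !mxE.
by apply/matrixP => i j; rewrite !mxE ffunE mxE.
Qed.

(** The columns being independent, the expectation of the product over the
    columns is the [n]-th power of a mean over sparse vectors, which
    [sum_norm_cos_le] bounds. *)
Lemma expected_tail_le m n t N (rho : R) : (t <= m)%N -> 0 <= rho -> rho <= 1 ->
  \sum_(A : 'M[bool]_(m, n)) (\prod_j col_law t (col j A)) *
    (\sum_(k : {ffun 'I_m -> 'I_N} | ~~ small_sin t rho (grid R k))
       \prod_l `|cos (phase (grid R k) (int_mx (col l A)))|) <=
  N%:R ^+ m * (1 - rho ^+ 2 / 2) ^+ n.
Proof.
move=> tm rho0 rho1.
have S0 : 0 < #|sparse_vecs m t|%:R :> R by rewrite ltr0n sparse_vecs_gt0.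
under eq_bigr do rewrite mulr_sumr.
rewrite exchange_big /=.
have y0 : 0 <= 1 - rho ^+ 2 / 2 by nra.
apply: (@le_trans _ _ (\sum_(k : {ffun 'I_m -> 'I_N}) (1 - rho ^+ 2 / 2) ^+ n)).
  rewrite big_mkcond; apply: ler_sum => k _; case: ifP => [big_k|_];
    last exact: exprn_ge0.
  under eq_bigr do rewrite -big_split.
  rewrite (sum_prod_col n
    (fun x => col_law t x * `|cos (phase (grid R k) (int_mx x))|)).
  apply: lerXn2r; rewrite ?nnegrE ?sumr_ge0//.
    by move=> x _; rewrite mulr_ge0// divr_ge0.
  have -> : \sum_x col_law t x * `|cos (phase (grid R k) (int_mx x))| =
      (\sum_(x in sparse_vecs m t) `|cos (phase (grid R k) (int_mx x))|) /
        #|sparse_vecs m t|%:R.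
    rewrite mulr_suml [RHS]big_mkcond; apply: eq_bigr => x _.
    by rewrite /col_law; case: ifP => _; rewrite ?mul0r// mul1r mulrC.
  rewrite ler_pdivrMr//; apply: sum_norm_cos_le => //.
  by rewrite ltW// ltNge.
by rewrite sumr_const card_ffun !card_ord -[leLHS]mulr_natl natrX.
Qed.

(** Markov's inequality: a bad matrix in the support of the law has tail at
    least 1. *)
Lemma sum_bad_le m n t (rho : R) :
  (0 < t < m)%N -> 0 <= rho -> 18 * m%:R * rho <= 1 ->
  \sum_(A : 'M[bool]_(m, n) | ~~ (disc (real_mx R A) <= 2))
    \prod_j col_law t (col j A) <=
  n.+3%:R ^+ m * (1 - rho ^+ 2 / 2) ^+ n.
Proof.
move=> tm rho0 rho_small.
have m1 : 1 <= m%:R :> R by rewrite ler1n; lia.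
apply: le_trans (@expected_tail_le m n t n.+3 rho _ rho0 _); [|lia|nra].
have law_ge0 (A : 'M[bool]_(m, n)) : 0 <= \prod_j col_law t (col j A).
  by apply: prodr_ge0 => j _; rewrite divr_ge0.
rewrite big_mkcond; apply: ler_sum => A _.
set tail := \sum_(k | _) _.
have tail0 : 0 <= tail by apply: sumr_ge0 => k _; apply: prodr_ge0.
case: ifPn => [disc_gt|_]; last exact: mulr_ge0.
have [/forallP colA|/forallPn[j jA]] :=
  boolP [forall j, col j A \in sparse_vecs m t].
  rewrite ler_peMr//; rewrite leNgt; apply: contra disc_gt => tail1.
  exact: disc_le2_of_tail tm rho0 rho_small colA tail1.
by rewrite (bigD1 j)//= /col_law (negPf jA) !mul0r.
Qed.

Lemma sum_bad_const m n t : t = 0 \/ t = m ->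
  \sum_(A : 'M[bool]_(m, n) | ~~ (disc (real_mx R A) <= 2))
    \prod_j col_law t (col j A) = 0.
Proof.
move=> t0m; apply: big1 => A disc_gt.
have [/forallP colA|/forallPn[j jA]] :=
  boolP [forall j, col j A \in sparse_vecs m t].
  suff AE : A = const_mx (t != 0)%N by rewrite AE disc_const_mx in disc_gt.
  apply/matrixP => i j; rewrite mxE; have := colA j; rewrite inE => /eqP tE.
  have : (i \in [set i | col j A i 0]%SET) = A i j by rewrite inE mxE.
  move=> <-; case: t0m => t_eq.
    by move: tE; rewrite t_eq eqxx => /eqP; rewrite cards_eq0 => /eqP ->; rewrite inE.
  have -> : [set i | col j A i 0]%SET = [set: 'I_m]%SET.
    by apply/eqP; rewrite eqEcard finset.subsetT cardsT card_ord tE t_eq leqnn.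
  by rewrite inE t_eq -lt0n (leq_ltn_trans _ (ltn_ord i)).
by rewrite (bigD1 j)//= /col_law (negPf jA) !mul0r.
Qed.
End Law.

(** * Numerical estimates *)

Section Calculus.
Variable R : realType.

Lemma ln2_ge : 1 / 2 <= ln 2 :> R.
Proof.
have := @le_ln1Dx R (- (1 / 2)); have -> : 1 + - (1 / 2) = 2^-1 :> R by lra.
by rewrite lnV ?posrE// => /(_ _); lra.
Qed.

Lemma ln_ge_half (m : R) : 2 <= m -> 1 / 2 <= ln m.
Proof.
by move=> m2; apply: le_trans ln2_ge _; rewrite ler_ln ?posrE//; lra.
Qed.

Lemma sixteen_sqr_le (K m n : R) : 2 <= m ->
  8 * K ^+ 2 * m ^+ 3 * ln m ^+ 2 <= n -> 16 * K ^+ 2 <= n.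
Proof.
move=> m2; apply: le_trans; rewrite -[8 * K ^+ 2 * _ * _]mulrA.
have lnm := ln_ge_half m2.
have m3 : 8 <= m ^+ 3.
  by have -> : 8 = 2 ^+ 3 :> R by [ring]; rewrite lerXn2r ?nnegrE//; lra.
have lnm2 : 1 / 4 <= ln m ^+ 2 by nra.
have mln : 2 <= m ^+ 3 * ln m ^+ 2 by nra.
by have := sqr_ge0 K; nra.
Qed.

(** If [n <= m ^ 12], then [ln n] is at most [12 ln m], which one of the two
    factors [ln m] absorbs.  Otherwise [m ^ 3] is at most [r], the fourth root
    of [n], and [ln n <= 4 r], so that the left side is at most [4 K r ^ 2];
    this is at most [r ^ 4 = n] because [n >= 16 K ^ 2]. *)
Lemma mul_ln_le (K m n : R) : 24 <= K -> 2 <= m ->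
  8 * K ^+ 2 * m ^+ 3 * ln m ^+ 2 <= n -> K * m ^+ 3 * ln n <= n.
Proof.
move=> K24 m2 n_ge; have n16 := sixteen_sqr_le m2 n_ge.
have lnm := ln_ge_half m2.
have m3 : 0 <= m ^+ 3 by apply: exprn_ge0; lra.
have n1 : 1 <= n by nra.
have n0 : 0 < n by lra.
have [n_le|n_gt] := leP n (m ^+ 12).
  have lnn : ln n <= 12 * ln m.
    by rewrite mulr_natl -lnXn ?ler_ln ?posrE ?exprn_gt0//; lra.
  apply: le_trans n_ge.
  have -> : 8 * K ^+ 2 * m ^+ 3 * ln m ^+ 2 =
      K * m ^+ 3 * (8 * K * ln m ^+ 2) by ring.
  apply: ler_wpM2l; first by nra.
  apply: le_trans lnn _.
  have : 24 * ln m ^+ 2 <= K * ln m ^+ 2 by apply: ler_wpM2r => //; nra.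
  by nra.
pose r := Num.sqrt (Num.sqrt n).
have r0 : 0 < r by rewrite !sqrtr_gt0.
have r4 : r ^+ 4 = n by rewrite (exprM r 2 2) !sqr_sqrtr ?sqrtr_ge0// ltW.
have m3r : m ^+ 3 <= r.
  rewrite -(@ler_pXn2r _ 4) ?nnegrE ?ltW// -?exprM ?r4//; nra.
have lnn : ln n <= 4 * r.
  rewrite -r4 lnXn// -[leLHS]mulr_natl ler_wpM2l//.
  have := @le_ln1Dx R (r - 1); have -> : 1 + (r - 1) = r by [ring].
  by move=> /(_ _); lra.
have r2K : 4 * K <= r ^+ 2.
  have : (4 * K) ^+ 2 <= (r ^+ 2) ^+ 2 by rewrite -exprM r4; nra.
  by rewrite ler_pXn2r ?nnegrE//; nra.
apply: (@le_trans _ _ (K * r * (4 * r))).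
  apply: ler_pM => //.
  - by apply: mulr_ge0; lra.
  - exact: ln_ge0.
  - by apply: ler_wpM2l => //; lra.
have -> : K * r * (4 * r) = 4 * K * r ^+ 2 by ring.
by rewrite -r4 (exprM r 2 2); nra.
Qed.

(** The first factor is at most [exp (2 m ln n)] and the second at most
    [exp (- n / (648 m ^ 2))]. *)
Lemma tail_le_inv (m n : nat) : (2 <= m)%N -> (3 <= n)%N ->
  2000 * m%:R ^+ 3 * ln n%:R <= n%:R :> R ->
  n.+3%:R ^+ m * (1 - (18 * m%:R)^-1 ^+ 2 / 2) ^+ n <= n%:R^-1 :> R.
Proof.
move=> m2 n3 n_ge.
have nR : 3 <= n%:R :> R by rewrite ler_nat.
have mR : 2 <= m%:R :> R by rewrite ler_nat.
have lnn : 0 <= ln n%:R :> R by apply: ln_ge0; lra.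
set y : R := (18 * m%:R)^-1 ^+ 2 / 2.
have y0 : 0 <= y by rewrite divr_ge0// sqr_ge0.
have y1 : y <= 1.
  have : (18 * m%:R)^-1 <= 1 :> R by rewrite invf_le1//; lra.
  have : 0 <= (18 * m%:R)^-1 :> R by rewrite invr_ge0; lra.
  by rewrite /y; nra.
have nE (j : nat) : n%:R ^+ j = expR (ln n%:R * j%:R) :> R.
  by rewrite expRM_natr lnK// posrE; lra.
have le1 : n.+3%:R ^+ m <= expR (ln n%:R * (2 * m)%N%:R) :> R.
  rewrite -nE exprM; apply: lerXn2r; rewrite ?nnegrE ?exprn_ge0//.
  by rewrite -natrX ler_nat; clear -n3; nia.
have le2 : (1 - y) ^+ n <= expR (- y * n%:R).
  by rewrite expRM_natr lerXn2r ?nnegrE ?expR_ge0 ?subr_ge0//; exact: expR_ge1Dx.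
apply: le_trans (ler_pM _ _ le1 le2) _; rewrite ?exprn_ge0 ?subr_ge0//.
have -> : n%:R^-1 = expR (- ln n%:R) :> R by rewrite expRN lnK// posrE; lra.
rewrite -expRD ler_expR.
have y_n : y * n%:R * (648 * m%:R ^+ 2) = n%:R.
  have wm : (18 * m%:R)^-1 * (18 * m%:R) = 1 :> R by rewrite mulVf//; lra.
  have -> : y * n%:R * (648 * m%:R ^+ 2) =
      n%:R * ((18 * m%:R)^-1 * (18 * m%:R)) ^+ 2.
    by rewrite /y; move: (18 * m%:R)^-1 => u; field.
  by rewrite wm expr1n mulr1.
have m2_gt0 : 0 < 648 * m%:R ^+ 2 :> R by nra.
suff : (2 * m%:R + 1) * ln n%:R <= y * n%:R by rewrite natrM; lra.
rewrite -(ler_pM2r m2_gt0) y_n; apply: le_trans n_ge.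
have -> : (2 * m%:R + 1) * ln n%:R * (648 * m%:R ^+ 2) =
  (2 * m%:R + 1) * (648 * m%:R ^+ 2) * ln n%:R :> R by ring.
apply: ler_wpM2r => //.
by have := exprn_ge0 2 (ler0n R m); rewrite !exprS !expr0; nra.
Qed.

Lemma inv_le_sqrt (m n : nat) : (1 <= m)%N -> (2 <= n)%N ->
  n%:R^-1 <= 2 * Num.sqrt (m%:R * ln n%:R / n%:R) :> R.
Proof.
move=> m1 n2.
have nR : 2 <= n%:R :> R by rewrite ler_nat.
have mR : 1 <= m%:R :> R by rewrite ler1n.
have lnn : 1 / 2 <= ln n%:R :> R.
  exact: ln_ge_half.
have i0 : 0 < n%:R^-1 :> R by rewrite invr_gt0; lra.
have i1 : n%:R^-1 <= 1 / 2 :> R by rewrite div1r lef_pV2 ?posrE//; lra.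
have : n%:R^-1 <= Num.sqrt (m%:R * ln n%:R / n%:R) :> R.
  rewrite -[leLHS]gtr0_norm// -sqrtr_sqr ler_wsqrtr// expr2 ler_wpM2r//; nra.
by lra.
Qed.
End Calculus.

(** * The theorem *)

Unset Implicit Arguments.
Set Strict Implicit.
Set Printing Implicit Defensive.

Theorem theorem1p9 (R : realType) :
  exists c C : R, [/\ 0 < c, 0 < C &
    forall (m t n : nat), (1 <= m)%N -> (t <= m)%N -> (1 <= n)%N ->
    c * m%:R ^+ 3 * ln (m%:R : R) ^+ 2 <= n%:R ->
    forall (d : measure_display) (T : measurableType d) (P : probability T R)
      (M : T -> 'M[bool]_(m, n)),
    random_sparse_mx P t M ->
    ((1 - C * Num.sqrt (m%:R * ln (n%:R : R) / n%:R))%:E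
      <= P [set w | (disc (real_mx R (M w)) <= 2)%R])%E].
Proof.
(* [2000 * m ^ 3] exceeds [(2 * m + 1) * (648 * m ^ 2)], the coefficient of [ln n]
   that the tail estimate has to beat. *)
have [K K_ge] : exists K : R, 2000 <= K by exists 2000.
exists (8 * K ^+ 2), 2; split => [||m t n m1 tm n1 n_ge d T P M randM] //.
  by apply: mulr_gt0 => //; apply: exprn_gt0; lra.
have /= := prob_notin_ge (fun A => ~~ (disc (real_mx R A) <= 2)) randM.
under eq_set do rewrite negbK.
apply: le_trans; rewrite lee_fin lerD2l lerN2.
have [t0m|t_mid] : (t = 0 \/ t = m)%N \/ (0 < t < m)%N by lia.
  by rewrite sum_bad_const// mulr_ge0.
have m2 : (2 <= m)%N by lia.
have mR : 2 <= m%:R :> R by rewrite ler_nat.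
have K24 : 24 <= K by lra.
have ln_le := mul_ln_le K24 mR n_ge.
have n3 : (3 <= n)%N.
  rewrite -(ler_nat R); apply: le_trans (sixteen_sqr_le mR n_ge).
  by nra.
have lnn : 0 <= ln n%:R :> R by apply: ln_ge0; rewrite ler1n.
have n_ge2000 : 2000 * m%:R ^+ 3 * ln n%:R <= n%:R :> R.
  apply: le_trans ln_le; apply: ler_wpM2r => //.
  by apply: (ler_wpM2r _ K_ge); exact: exprn_ge0.
apply: (le_trans _ (inv_le_sqrt R m1 (ltnW n3))).
apply: (le_trans _ (tail_le_inv m2 n3 n_ge2000)).
apply: sum_bad_le => //.
by rewrite divff//; lra.
Qed.
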